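(* Let $K_n$ denote the complete graph with $n$ vertices. If $n=3m$ for some positive integer $m$, then $$\|M_{K_{3m}}\|_2=\left(\frac43\right)^{1/2}.$$ For $n=2$ we have $$\|M_{K_2}\|_2=\frac{(3+5^{1/2})^{1/2}}{2}.$$
   Context: For a finite connected graph $G=(V,E)$, let $d_G(u,v)$ be the number of edges in a shortest path connecting $u$ and $v$, and let $B(e,r)=\{m\in V: d_G(e,m)\le r\}$. For $f:V\to\mathbb{R}$ the centered Hardy–Littlewood maximal function is $$M_Gf(e)=\max_{r\ge 0}\frac{1}{|B(e,r)|}\sum_{m\in B(e,r)}|f(m)|,\qquad e\in V.$$ With $\|g\|_2=\big(\sum_{e\in V}|g(e)|^2\big)^{1/2}$ for $g:V\to\mathbb{R}$, define $$\|M_G\|_2=\sup_{f:V\to\mathbb{R},\ f\ne0}\frac{\|M_Gf\|_2}{\|f\|_2}.$$ *)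

(* Defs.v *)
From mathcomp Require Import all_boot all_order all_algebra.
From mathcomp Require Import all_classical all_reals.

Set Implicit Arguments.
Unset Strict Implicit.
Unset Printing Implicit Defensive.

Import Order.TTheory GRing.Theory Num.Theory.
Local Open Scope classical_set_scope.
Local Open Scope ring_scope.

Record connGraph := ConnGraph {
  vertex :> finType;
  edge : rel vertex;
  edge_sym : symmetric edge;
  edge_irr : irreflexive edge;
  edge_conn : forall u v : vertex, connect edge u v }.

Section Distance.
Variable G : connGraph.

(* [has_walk u v k] allows repeated vertices; this does not affect the
   minimal length. *)
Definition has_walk (u v : G) (k : nat) : bool :=
  [exists p : k.-tuple G, path (@edge G) u p && (last u p == v)].

Lemma has_walk_ex (u v : G) : exists k, has_walk u v k.
Proof.
have /connectP[p ep ->] := edge_conn u v.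
by exists (size p); apply/existsP; exists (in_tuple p); rewrite ep eqxx.
Qed.

Definition gdist (u v : G) : nat := ex_minn (has_walk_ex u v).

End Distance.

Section MaximalFunction.
Variables (R : realType) (G : connGraph).

Definition gball (e : G) (r : R) : {set G} := [set m : G | (gdist e m)%:R <= r]%SET.

Definition ball_avg (f : G -> R) (e : G) (r : R) : R :=
  (#|gball e r|%:R)^-1 * \sum_(m in gball e r) `|f m|.

(* The set of averages is finite, so this supremum is a maximum: see
   [maximal_ub] and [maximal_attained]. *)
Definition maximal (f : G -> R) (e : G) : R :=
  sup [set ball_avg f e r | r in [set r : R | 0 <= r]].

Definition l2norm (g : G -> R) : R := Num.sqrt (\sum_(e : G) `|g e| ^+ 2).

Definition maximal_opnorm : R :=
  sup [set l2norm (maximal f) / l2norm f | f in [set f : G -> R | f != 0]].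

Lemma ball_avg_bounded (f : G -> R) (e : G) :
  has_sup [set ball_avg f e r | r in [set r : R | 0 <= r]].
Proof.
split; first by exists (ball_avg f e 0); exists 0 => /=.
pose h (A : {set G}) : R := (#|A|%:R)^-1 * \sum_(m in A) `|f m|.
exists (\sum_(A : {set G}) h A) => _ [r _ <-].
rewrite -/(h (gball e r)) (bigD1 (gball e r)) //= lerDl sumr_ge0 // => A _.
by rewrite mulr_ge0 ?invr_ge0 ?ler0n // sumr_ge0.
Qed.

Lemma maximal_ub (f : G -> R) (e : G) (r : R) :
  0 <= r -> ball_avg f e r <= maximal f e.
Proof.
by move=> r0; apply: ub_le_sup; [case: (ball_avg_bounded f e)|exists r].
Qed.

Lemma maximal_attained (f : G -> R) (e : G) :
  exists2 r : R, 0 <= r & maximal f e = ball_avg f e r.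
Proof.
pose h (A : {set G}) : R := (#|A|%:R)^-1 * \sum_(m in A) `|f m|.
pose P := [pred A : {set G} | `[< exists2 r : R, 0 <= r & A = gball e r >]].
have P0 : P (gball e 0) by apply/asboolP; exists 0.
case: (arg_maxP h P0) => A /asboolP[r r0 ->] hA.
exists r => //; apply/eqP; rewrite eq_le maximal_ub // andbT.
apply: ge_sup; first by case: (ball_avg_bounded f e).
by move=> _ [s /= s0 <-]; apply: hA; apply/asboolP; exists s.
Qed.

End MaximalFunction.

Arguments maximal_opnorm R G : clear implicits.

Definition complete_rel (n : nat) : rel 'I_n := fun i j => i != j.

Lemma complete_sym n : symmetric (@complete_rel n).
Proof. by move=> i j; rewrite /complete_rel eq_sym. Qed.

Lemma complete_irr n : irreflexive (@complete_rel n).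
Proof. by move=> i; rewrite /complete_rel eqxx. Qed.

Lemma complete_conn n (i j : 'I_n) : connect (@complete_rel n) i j.
Proof. by have [->|ij] := eqVneq i j; [exact: connect0|exact: connect1]. Qed.

Definition complete_graph (n : nat) : connGraph :=
  ConnGraph (@complete_sym n) (@complete_irr n) (@complete_conn n).

(* Main.v *)
Require Import Defs.
From mathcomp Require Import all_boot all_order all_algebra.
From mathcomp Require Import all_classical all_reals.
From mathcomp Require Import ring lra.

Import Order.TTheory GRing.Theory Num.Theory.
Local Open Scope ring_scope.

(** In a complete graph every ball is a single vertex or the whole graph, so
    [maximal f e] is the larger of [`|f e|] and the mean [a] of [`|f|]
    ([maximal_complete]).  The operator norm is thus the square root of the best
    constant [C] in the inequality [\sum max(t_i, a)^2 <= C * \sum t_i^2] between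
    nonnegative numbers [t_i] of mean [a] ([maximal_opnorm_sqrt]).

    For any number of vertices, [C = 4/3] works: the quadratic inequality
    [max(t, a)^2 <= 4/3 * t^2 - 4/3 * a * (t - a)] holds for every [t], and
    its last term sums to zero over the vertices.  The multiplier [-4/3] makes
    the gap between the two sides a perfect square on each side of [a], with
    zeros exactly at [t = a/2] and [t = 2a].  Equality therefore asks for a
    function with values in [{a/2, 2a}] and mean [a], that is, with the large
    value on exactly one third of the vertices, which is possible when the
    number of vertices is [3m].

    On two vertices, with values [x >= y >= 0], the left-hand side is the
    quadratic form [x^2 + ((x + y)/2)^2].  The best constant is the largest
    eigenvalue [(3 + sqrt 5)/4] of its matrix, and the eigenvector
    [(sqrt 5 + 2, 1)] satisfies [x >= y >= 0], so it is an extremiser. *)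

Lemma sum_norm_sqr_gt0 (R : realType) (G : connGraph) (f : G -> R) :
  f != 0 -> 0 < \sum_(e : G) `|f e| ^+ 2.
Proof.
move=> f0; rewrite lt_def sumr_ge0 ?andbT; last by move=> e _; exact: sqr_ge0.
apply: contra f0 => /eqP sf0; apply/eqP/funext => e.
have /eqP := psumr_eq0P (fun i (_ : true) => sqr_ge0 `|f i|) sf0 (erefl : xpredT e).
by rewrite sqrf_eq0 normr_eq0 => /eqP.
Qed.

Lemma maximal_opnorm_sqrt (R : realType) (G : connGraph) (C : R) (f0 : G -> R) :
  f0 != 0 ->
  (forall f : G -> R,
     \sum_e `|maximal f e| ^+ 2 <= C * \sum_e `|f e| ^+ 2) ->
  \sum_e `|maximal f0 e| ^+ 2 = C * \sum_e `|f0 e| ^+ 2 ->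
  maximal_opnorm R G = Num.sqrt C.
Proof.
move=> f00 ubC eqC.
have ratioE (f : G -> R) (f_n0 : f != 0) : l2norm (maximal f) / l2norm f =
    Num.sqrt ((\sum_e `|maximal f e| ^+ 2) / \sum_e `|f e| ^+ 2).
  rewrite sqrtrM; last by rewrite sumr_ge0 // => e _; exact: sqr_ge0.
  by rewrite sqrtrV // ltW // sum_norm_sqr_gt0.
have le_ratio (f : G -> R) : f != 0 -> l2norm (maximal f) / l2norm f <= Num.sqrt C.
  by move=> fn0; rewrite ratioE // ler_wsqrtr // ler_pdivrMr ?sum_norm_sqr_gt0.
have attained : l2norm (maximal f0) / l2norm f0 = Num.sqrt C.
  by rewrite ratioE // eqC mulfK // gt_eqF // sum_norm_sqr_gt0.
apply/eqP; rewrite eq_le; apply/andP; split.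
  apply: ge_sup; first by exists (Num.sqrt C), f0.
  by move=> _ [f fn0 <-]; exact: le_ratio.
apply: ub_le_sup; last by exists f0.
by exists (Num.sqrt C) => _ [f fn0 <-]; exact: le_ratio.
Qed.

Lemma gdist_complete n (i j : complete_graph n) : gdist i j = (i != j) :> nat.
Proof.
rewrite /gdist; case: ex_minnP => k wk kmin.
have [ij|ij] := eqVneq i j.
  apply/eqP; rewrite -leqn0 kmin //.
  by apply/existsP; exists [tuple]; rewrite /= ij.
apply/eqP; rewrite eqn_leq kmin /=; last first.
  by apply/existsP; exists [tuple j]; rewrite /= /complete_rel ij eqxx.
case: k wk {kmin} => // /existsP[p]; rewrite tuple0 /= => ji.
by rewrite ji in ij.
Qed.

Definition mean {R : realType} {T : finType} (g : T -> R) : R :=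
  (#|T|%:R)^-1 * \sum_x g x.

Lemma maximal_complete (R : realType) n (f : complete_graph n -> R)
    (e : complete_graph n) :
  maximal f e = Num.max `|f e| (mean (fun i => `|f i|)).
Proof.
have avg_small r : 0 <= r -> r < 1 -> ball_avg f e r = `|f e|.
  move=> r0 r1; rewrite /ball_avg.
  have -> : gball e r = [set e]%SET.
    apply/setP => i; rewrite !inE gdist_complete eq_sym.
    by case: eqP => /= _; rewrite ?r0 // leNgt r1.
  by rewrite big_set1 cards1 invr1 mul1r.
have avg_large r : 1 <= r -> ball_avg f e r = mean (fun i => `|f i|).
  move=> r1; rewrite /ball_avg.
  have -> : gball e r = [set: complete_graph n]%SET.
    apply/setP => i; rewrite !inE gdist_complete.
    by rewrite (le_trans _ r1) // lern1 leq_b1.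
  by rewrite cardsT; congr (_ * _); apply: eq_bigl => i; rewrite inE.
apply/eqP; rewrite eq_le ge_max.
rewrite -{2}(avg_small 0) // -(avg_large 1) // !maximal_ub // !andbT.
have [r r0 ->] := maximal_attained f e.
rewrite le_max; have [r1|r1] := ltP r 1; first by rewrite avg_small ?lexx.
by rewrite (avg_large 1) // (avg_large r) // lexx orbT.
Qed.

Lemma norm_maximal_complete (R : realType) n (f : complete_graph n -> R)
    (e : complete_graph n) :
  `|maximal f e| = maximal f e.
Proof. by rewrite ger0_norm // maximal_complete le_max normr_ge0. Qed.

Lemma max_sqr_le (R : realType) (t a : R) :
  Num.max t a ^+ 2 <= 4 / 3 * t ^+ 2 - 4 / 3 * a * (t - a).
Proof.
have [ta|ta] := leP t a; rewrite -subr_ge0.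
  have -> : 4 / 3 * t ^+ 2 - 4 / 3 * a * (t - a) - a ^+ 2
            = 4 / 3 * (t - a / 2) ^+ 2 by field.
  by rewrite mulr_ge0 ?sqr_ge0 // divr_ge0.
have -> : 4 / 3 * t ^+ 2 - 4 / 3 * a * (t - a) - t ^+ 2
          = 3^-1 * (t - 2 * a) ^+ 2 by field.
by rewrite mulr_ge0 ?sqr_ge0 // invr_ge0.
Qed.

Lemma sum_sub_mean (R : realType) (T : finType) (g : T -> R) :
  \sum_x (g x - mean g) = 0.
Proof.
have -> : \sum_x (g x - mean g) = \sum_x g x - #|T|%:R * mean g.
  by rewrite sumrB sumr_const mulr_natl.
rewrite /mean.
have [T0|Tn0] := eqVneq #|T| 0%N.
  rewrite T0 mul0r subr0 big_pred0 // => x.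
  by have := fintype0 x T0.
by rewrite mulVKf ?subrr // pnatr_eq0.
Qed.

Lemma maximal_complete_le (R : realType) n (f : complete_graph n -> R) :
  \sum_e `|maximal f e| ^+ 2 <= 4 / 3 * \sum_e `|f e| ^+ 2.
Proof.
set a := mean (fun i => `|f i|).
have -> : 4 / 3 * \sum_e `|f e| ^+ 2 =
    \sum_e (4 / 3 * `|f e| ^+ 2 - 4 / 3 * a * (`|f e| - a)).
  by rewrite sumrB -!mulr_sumr sum_sub_mean mulr0 subr0.
apply: ler_sum => e _; rewrite norm_maximal_complete maximal_complete.
exact: max_sqr_le.
Qed.

Lemma sum_first_third (R : realType) m (a b : R) :
  \sum_(i < 3 * m) (if (i < m)%N then a else b) = m%:R * (a + 2 * b).
Proof.
have -> : (3 * m = m + 2 * m)%N by rewrite mulSn.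
rewrite -(big_mkord xpredT (fun i => if (i < m)%N then a else b)).
rewrite (@big_cat_nat _ _ _ m) ?leq_addr //=.
rewrite (eq_big_nat _ _ (F2 := fun=> a)); last by move=> i /andP[_ ->].
rewrite [X in _ + X](eq_big_nat _ _ (F2 := fun=> b)); last first.
  by move=> i /andP[mi _]; rewrite ltnNge mi.
rewrite !sumr_const_nat subn0 addKn -[a *+ _]mulr_natl -[b *+ _]mulr_natl natrM.
by ring.
Qed.

Lemma maximal_opnorm_complete3 (R : realType) m : (0 < m)%N ->
  maximal_opnorm R (complete_graph (3 * m)) = Num.sqrt (4 / 3).
Proof.
move=> m_gt0.
have mR0 : m%:R != 0 :> R by rewrite pnatr_eq0 -lt0n.
(* The mean is 2, so the values are its double and its half. *)
pose f (i : complete_graph (3 * m)) : R := if (i < m)%N then 4 else 1.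
have fE i : `|f i| = f i by rewrite ger0_norm // /f; case: ifP.
have mean_f : mean (fun i => `|f i|) = 2.
  rewrite /mean (eq_bigr _ (fun i _ => fE i)) sum_first_third card_ord natrM.
  by field.
have MfE i : maximal f i = if (i < m)%N then 4 else 2.
  rewrite maximal_complete mean_f fE /f; case: ifP => _.
    by rewrite max_l // ler_nat.
  by rewrite max_r // ler1n.
apply: (maximal_opnorm_sqrt _ _ _ f); last 1 first.
- rewrite (eq_bigr (fun i : 'I_(3 * m) => if (i < m)%N then 16 else 4)).
    rewrite [in RHS](eq_bigr (fun i : 'I_(3 * m) => if (i < m)%N then 16 else 1)).
      by rewrite !sum_first_third; field.
    by move=> i _; rewrite fE /f; case: ifP => _; ring.
  by move=> i _; rewrite norm_maximal_complete MfE; case: ifP => _; ring.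
- have n_gt0 : (0 < 3 * m)%N by rewrite muln_gt0.
  apply/eqP => /(congr1 (fun g => g (Ordinal n_gt0))) /eqP.
  by rewrite /f /= m_gt0 pnatr_eq0.
- exact: maximal_complete_le.
Qed.

Lemma sum_complete2 (R : realType) (F : complete_graph 2 -> R) :
  \sum_e F e = F (ord0 : 'I_2) + F (ord_max : 'I_2).
Proof.
rewrite (_ : \sum_e F e = \sum_(i < 2) F i) //.
rewrite big_ord_recr big_ord_recl big_ord0 /= addr0.
by congr (F _ + F _); apply: val_inj.
Qed.

Lemma sum_maximal_complete2 (R : realType) (f : complete_graph 2 -> R) :
  let x := `|f (ord0 : 'I_2)| in let y := `|f (ord_max : 'I_2)| in
  \sum_e `|maximal f e| ^+ 2 =
  Num.max x ((x + y) / 2) ^+ 2 + Num.max y ((x + y) / 2) ^+ 2.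
Proof.
move=> x y; rewrite sum_complete2 !norm_maximal_complete !maximal_complete.
by rewrite /mean sum_complete2 card_ord mulrC.
Qed.

(** As [(3 + s) / 4] is the largest eigenvalue of the quadratic form on the left,
    the gap is a degenerate nonnegative form, hence a multiple of the square of a
    linear form vanishing on the eigenvector [(s + 2, 1)]. *)
Lemma golden_form_le (R : realType) (x y s : R) : 0 <= s -> s ^+ 2 = 5 ->
  x ^+ 2 + ((x + y) / 2) ^+ 2 <= (3 + s) / 4 * (x ^+ 2 + y ^+ 2).
Proof.
move=> s0 s2; rewrite -subr_ge0.
have -> : (3 + s) / 4 * (x ^+ 2 + y ^+ 2) - (x ^+ 2 + ((x + y) / 2) ^+ 2)
          = (s + 2) / 4 * (y - (s - 2) * x) ^+ 2 by field: s2.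
by rewrite mulr_ge0 ?sqr_ge0 // divr_ge0 // addr_ge0.
Qed.

Lemma maximal_opnorm_complete2 (R : realType) :
  maximal_opnorm R (complete_graph 2) = Num.sqrt (3 + Num.sqrt 5) / 2.
Proof.
set s : R := Num.sqrt 5.
have s0 : 0 <= s by exact: sqrtr_ge0.
have s2 : s ^+ 2 = 5 by rewrite sqr_sqrtr.
have -> : Num.sqrt (3 + s) / 2 = Num.sqrt ((3 + s) / 4).
  rewrite sqrtrM ?addr_ge0 //; congr (_ * _).
  have -> : 4^-1 = (2^-1) ^+ 2 :> R by field.
  by rewrite sqrtr_sqr ger0_norm ?invr_ge0.
(* The eigenvector for the eigenvalue (3 + s) / 4. *)
pose f (i : complete_graph 2) : R := if i == (ord0 : 'I_2) then s + 2 else 1.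
apply: (maximal_opnorm_sqrt _ _ _ f).
- apply/eqP => /(congr1 (fun g => g (ord_max : 'I_2))) /eqP.
  by rewrite /f /= oner_eq0.
- move=> g; rewrite sum_maximal_complete2 sum_complete2.
  set x := `|g _|; set y := `|g _|.
  have [xy|yx] := leP x y.
    rewrite max_r; last lra.
    rewrite max_l; last lra.
    rewrite addrC [x + y]addrC [x ^+ 2 + _]addrC; exact: golden_form_le.
  rewrite max_l; last lra.
  rewrite max_r; last lra.
  exact: golden_form_le.
- rewrite sum_maximal_complete2 sum_complete2 /f /= normr1 ger0_norm; last lra.
  rewrite max_l; last lra.
  rewrite max_r; last lra.
  by field: s2.
Qed.

Theorem corollary5 (R : realType) :
  (forall m : nat, (0 < m)%N ->
     maximal_opnorm R (complete_graph (3 * m)) = Num.sqrt (4 / 3)) /\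
  maximal_opnorm R (complete_graph 2) = Num.sqrt (3 + Num.sqrt 5) / 2.
Proof.
split; first exact: maximal_opnorm_complete3.
exact: maximal_opnorm_complete2.
Qed.
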